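(* Let $I=[a,b]$ be a compact interval, let $g:I\to\mathbb R$ be left-continuous and nondecreasing, and let $\alpha>1$. Then, for every $a\le s<t\le b$, $$\inf_P\sum_{i=1}^n[g(t_i)-g(t_{i-1})]^\alpha=\sum_{\substack{\tau\in[s,t)\\ \Delta^+g(\tau)>0}}[\Delta^+g(\tau)]^\alpha,$$ where the infimum is taken over all finite partitions $P:s=t_0<t_1<\cdots<t_n=t$ of $[s,t]$. (No restriction is placed on the number or distribution of the jump points of $g$.)
   Context: For $\tau\in[a,b)$, $\Delta^+g(\tau)=g(\tau+)-g(\tau)$ is the right jump of $g$ at $\tau$, where $g(\tau+)=\lim_{r\downarrow\tau}g(r)$. Equivalently, the points $\tau\in[s,t)$ with $\Delta^+g(\tau)>0$ are the atoms in $[s,t)$ of the Stieltjes measure $\mu_g$ determined by $\mu_g([s,t))=g(t)-g(s)$, with $\mu_g(\{\tau\})=\Delta^+g(\tau)$. *)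

(* Defs.v *)
From mathcomp Require Import all_boot all_order all_algebra.
From mathcomp Require Import all_classical all_reals all_analysis.

Set Implicit Arguments.
Unset Strict Implicit.
Unset Printing Implicit Defensive.

Import Order.TTheory GRing.Theory Num.Theory.
Import numFieldNormedType.Exports.

Local Open Scope classical_set_scope.
Local Open Scope ring_scope.

(* A function on the interval [a, b] is represented by a total function
   R -> R whose values outside [a, b] are unconstrained and irrelevant. *)

(* The left endpoint a is excluded: nothing in [a, b] lies to its left. *)
Definition left_continuous_on (R : realType) (a b : R) (g : R -> R) : Prop :=
  forall x, x \in `]a, b] -> g y @[y --> x^'-] --> g x.

Definition right_jump (R : realType) (g : R -> R) (x : R) : R :=
  lim (g y @[y --> x^'+]) - g x.

(* As with the library's [variation], a partition s = t_0 < ... < t_n = t is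
   the list p = [:: t_1; ...; t_n] satisfying [itv_partition s t p]. *)
Definition power_sum (R : realType) (alpha : R) (g : R -> R) (s t : R)
    (p : seq R) : R :=
  \sum_(0 <= i < size p)
    (g (nth t (s :: p) i.+1) - g (nth t (s :: p) i)) `^ alpha.

(* Main.v *)
(* Lower bound: on a cell [u, v) the jumps of g sum to at most g v - g u, and
   x |-> x ^ alpha is superadditive for alpha >= 1, so any finite sum of powers
   of jumps is at most any power sum.  Upper bound: fix e > 0 and call a cell
   [u, v] fine when (g v - g u) ^ alpha <= (jump at u) ^ alpha + e (g v - g u).
   Every short cell with left endpoint x is fine because g v - g x tends to the
   jump at x, and every short cell with right endpoint x is fine because
   g x - g u tends to 0 by left continuity, while d ^ alpha <= e d for small d.
   Hence [s, t] has a partition into fine cells, whose power sum is at most the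
   sum of the powers of the jumps plus e (g t - g s). *)
Require Import Defs.
From mathcomp Require Import all_boot all_order all_algebra.
From mathcomp Require Import finmap.
From mathcomp Require Import all_classical all_reals all_analysis.
Import Order.TTheory GRing.Theory Num.Theory.
Import numFieldNormedType.Exports.
Local Open Scope classical_set_scope.
Local Open Scope ring_scope.

Set Implicit Arguments.
Unset Strict Implicit.

Lemma power_sum_nil (R : realType) (alpha : R) (g : R -> R) (s t : R) :
  power_sum alpha g s t [::] = 0.
Proof. by rewrite /power_sum big_geq. Qed.

Lemma power_sum_cons (R : realType) (alpha : R) (g : R -> R) (s t x : R)
    (p : seq R) :
  power_sum alpha g s t (x :: p) =
  (g x - g s) `^ alpha + power_sum alpha g x t p.
Proof. by rewrite /power_sum /= big_nat_recl. Qed.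

(** * Right jumps of a nondecreasing function *)

Lemma right_jump_cvg (R : realType) (a b : R) (g : R -> R) (x : R) :
  {in `[a, b] &, {homo g : u v / u <= v}} -> a <= x -> x < b ->
  g y @[y --> x^'+] --> g x + right_jump g x.
Proof.
move=> gnd ax xb; rewrite /right_jump addrC subrK.
have sub u : u \in Interval (BRight x) (BRight b) -> u \in `[a, b].
  by rewrite !in_itv/= => /andP[xu ->]; rewrite (le_trans ax (ltW xu)).
(* [lim] is meaningful only once convergence is known; it follows from monotonicity, [g x] being a
   lower bound of [g] on []x, b[]. *)
apply: (cvgP (inf (g @` [set` Interval (BRight x) (BRight b)]))).
apply: nondecreasing_at_right_cvgr.
- by rewrite bnd_simp.
- by move=> u v /sub u_ab /sub v_ab; exact: gnd.
- exists (g x) => _ [u /= u_xb <-]; apply: gnd => //; last first.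
    by move: u_xb; rewrite in_itv/= => /andP[/ltW].
  - exact: sub.
  - by rewrite in_itv/= ax ltW.
Qed.

Lemma right_jump_ge0 (R : realType) (a b : R) (g : R -> R) (x : R) :
  {in `[a, b] &, {homo g : u v / u <= v}} -> a <= x -> x < b ->
  0 <= right_jump g x.
Proof.
move=> gnd ax xb; rewrite -(lerD2l (g x)) addr0.
apply: (cvgr_to_ge (right_jump_cvg gnd ax xb)).
near=> y.
have xy : x < y by near: y; exact: nbhs_right_gt.
have yb : y <= b by near: y; exact: nbhs_right_ltW.
by apply: gnd; rewrite ?in_itv/= ?ax ?yb ?(ltW xb) ?(le_trans ax) ?ltW.
Unshelve. all: by end_near. Qed.

Lemma right_jump_le (R : realType) (a b : R) (g : R -> R) (x z : R) :
  {in `[a, b] &, {homo g : u v / u <= v}} -> a <= x -> x < z -> z <= b ->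
  right_jump g x <= g z - g x.
Proof.
move=> gnd ax xz zb; rewrite lerBrDl.
apply: (cvgr_to_le (right_jump_cvg gnd ax (lt_le_trans xz zb))).
near=> y.
have xy : x < y by near: y; exact: nbhs_right_gt.
have yz : y <= z by near: y; exact: nbhs_right_ltW.
apply: gnd => //; rewrite in_itv/= ?zb ?(le_trans yz) ?andbT//.
- by rewrite (le_trans ax) ?ltW.
- by rewrite (le_trans ax) ?ltW.
Unshelve. all: by end_near. Qed.

(** * Jumps against increments, and the lower bound *)

Lemma sum_right_jump_le (R : realType) (a b : R) (g : R -> R) (A : seq R)
    (s t : R) :
  {in `[a, b] &, {homo g : u v / u <= v}} -> uniq A ->
  a <= s -> s <= t -> t <= b ->
  \sum_(x <- A | s <= x < t) right_jump g x <= g t - g s.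
Proof.
move=> gnd uA as_ st tb.
rewrite -big_filter -(perm_big _ (permEl (perm_sort <=%O _))) /=.
set B := sort _ _.
have sB : sorted <%O B by rewrite sort_lt_sorted filter_uniq.
have : {in B, forall x, s <= x < t}.
  by move=> x; rewrite mem_sort mem_filter => /andP[].
(* Induction from the right: the jump at the last point [x] is at most [g t - g x], and the other
   points lie in [[s, x)], so [x] replaces [t]. *)
clearbody B; elim/last_ind: B t st tb sB => [|B x IH] t st tb sB Bst.
  rewrite big_nil subr_ge0; apply: gnd => //.
  - by rewrite in_itv/= as_ (le_trans st).
  - by rewrite in_itv/= tb (le_trans as_).
have /andP[sx xt] : s <= x < t by apply: Bst; rewrite mem_rcons mem_head.
rewrite big_rcons/= -(subrKA (g x) (g t)) addrC lerD//.
  by apply: (right_jump_le gnd) => //; exact: le_trans sx.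
move: sB; rewrite -cats1 (sorted_pairwise lt_trans) pairwise_cat.
rewrite -(sorted_pairwise lt_trans) allrel1r => /and3P[/allP Bx sB _].
apply: IH => //; first exact: le_trans (ltW xt) tb.
move=> y yB; rewrite Bx// andbT.
by have /andP[] : s <= y < t by apply: Bst; rewrite mem_rcons inE yB orbT.
Qed.

Lemma sum_powR_le (R : realType) (T : Type) (A : seq T) (P : pred T)
    (F : T -> R) (c alpha : R) :
  1 <= alpha -> (forall x, P x -> 0 <= F x <= c) ->
  \sum_(x <- A | P x) F x <= c ->
  \sum_(x <- A | P x) F x `^ alpha <= c `^ alpha.
Proof.
move=> al1 F0c Sc; have al0 := lt_le_trans ltr01 al1.
have c0 : 0 <= c.
  by apply: le_trans Sc; apply: sumr_ge0 => x /F0c/andP[].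
rewrite -mulr_powRB1//.
apply: le_trans (ler_wpM2r (powR_ge0 _ _) Sc).
rewrite mulr_suml; apply: ler_sum => x /F0c/andP[F0 Fc].
by rewrite -mulr_powRB1// ler_wpM2l// ge0_ler_powR// subr_ge0.
Qed.

Lemma sum_right_jump_powR_le_power_sum (R : realType) (a b : R) (g : R -> R)
    (alpha : R) (A p : seq R) (s t : R) :
  {in `[a, b] &, {homo g : u v / u <= v}} -> 1 <= alpha -> uniq A ->
  a <= s -> t <= b -> itv_partition s t p ->
  \sum_(x <- A | s <= x < t) right_jump g x `^ alpha <=
  power_sum alpha g s t p.
Proof.
move=> gnd al1 uA as_ tb; elim: p s as_ => [|x p IH] s as_.
  move=> /itv_partition_nil ->; rewrite power_sum_nil big_pred0// => y.
  by case: leP => //=; case: ltP.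
move=> stp; have xtp := itv_partition_cons stp.
have xt : x <= t := itv_partition_le xtp.
have sx : s < x by case: stp => /andP[].
have xb := le_trans xt tb.
(* The points of [A] before [x] are charged to the first cell by superadditivity, the others to the
   remaining cells by induction. *)
rewrite power_sum_cons (bigID (fun y => y < x))/= lerD//.
- rewrite (eq_bigl (fun y => s <= y < x)); last first.
    move=> y; rewrite -andbA; congr andb.
    by case: (ltP y x) => [yx|_]; rewrite ?andbF ?andbT// (lt_le_trans yx).
  apply: sum_powR_le => // [y /andP[sy yx]|].
    have ay := le_trans as_ sy.
    rewrite (right_jump_ge0 gnd ay (lt_le_trans yx xb)) /=.
    apply: le_trans (right_jump_le gnd ay yx xb) _.
    rewrite lerD2l lerN2; apply: gnd => //.
    + by rewrite in_itv/= as_ (le_trans _ xb)// ltW.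
    + by rewrite in_itv/= ay (le_trans _ xb)// ltW.
  by apply: (sum_right_jump_le gnd) => //; exact: ltW.
- rewrite (eq_bigl (fun y => x <= y < t)).
    by apply: IH => //; rewrite (le_trans as_) ?ltW.
  move=> y; rewrite -leNgt andbAC; congr andb.
  by case: (leP x y) => [xy|_]; rewrite ?andbF// (le_trans (ltW sx)).
Qed.

(* The error allowed on a cell is proportional to the increment of [g], so that
   the errors add up to at most [e * (g t - g s)] whatever the number of
   cells. *)
Definition fine_cell (R : realType) (g : R -> R) (alpha e u v : R) : bool :=
  (u < v) &&
  ((g v - g u) `^ alpha <= right_jump g u `^ alpha + e * (g v - g u)).

(** * Thresholds that make short cells fine *)

Lemma powR_invK (R : realType) (x r : R) :
  0 <= x -> r != 0 -> (x `^ r^-1) `^ r = x.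
Proof. by move=> x0 r0; rewrite -powRrM mulVf// powRr1. Qed.

Lemma powR_le_mul (R : realType) (alpha e x : R) :
  1 < alpha -> 0 < e -> 0 <= x -> x <= e `^ (alpha - 1)^-1 ->
  x `^ alpha <= e * x.
Proof.
move=> al1 e0 x0 xe; have al0 : 0 < alpha - 1 by rewrite subr_gt0.
rewrite -mulr_powRB1 ?(lt_trans ltr01)// mulrC ler_wpM2r//.
rewrite -[leRHS](powR_invK (ltW e0) (lt0r_neq0 al0)).
by rewrite ge0_ler_powR// ?nnegrE ?powR_ge0// ltW.
Qed.

Lemma fine_cell_right (R : realType) (a b : R) (g : R -> R) (alpha e x : R) :
  {in `[a, b] &, {homo g : u v / u <= v}} -> 1 < alpha -> 0 < e ->
  a <= x -> x < b ->
  \forall y \near x^'+, fine_cell g alpha e x y.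
Proof.
move=> gnd al1 e0 ax xb; have al0 := lt_trans ltr01 al1.
have := right_jump_ge0 gnd ax xb; set J := right_jump g x => J0.
have gJ : g y - g x @[y --> x^'+] --> J.
  have -> : J = g x + J - g x by rewrite addrC addrA addNr add0r.
  by apply: cvgB; [exact: (right_jump_cvg gnd ax xb)|exact: cvg_cst].
(* An increment [d] with [J <= d <= h] meets the fineness bound: for [J > 0], [h]^ alpha = J
   [^ alpha + e * J] and [e * J <= e * d]; for [J = 0] this would give [h = 0], so the threshold of
   [powR_le_mul] is used. *)
pose h := if J == 0 then e `^ (alpha - 1)^-1
          else (J `^ alpha + e * J) `^ alpha^-1.
have Jh : J < h.
  rewrite /h; have [->|Jn0] := eqVneq J 0; first exact: powR_gt0.
  have Jgt0 : 0 < J by rewrite lt_neqAle eq_sym Jn0.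
  rewrite -[ltLHS](powR_invK J0 (invr_neq0 (lt0r_neq0 al0))) invrK.
  apply: gt0_ltr_powR; rewrite ?nnegrE ?invr_gt0 ?powR_ge0//.
    by rewrite addr_ge0 ?powR_ge0// mulr_ge0// ltW.
  by rewrite ltrDl mulr_gt0.
near=> y.
have xy : x < y by near: y; exact: nbhs_right_gt.
have yb : y <= b by near: y; exact: nbhs_right_ltW.
have yh : g y - g x < h.
  by near: y; exact: (cvgr_lt _ gJ).
have Jy : J <= g y - g x := right_jump_le gnd ax xy yb.
have y0 := le_trans J0 Jy.
rewrite /fine_cell xy /= -/J; move: yh; rewrite /h.
have [->|Jn0] := eqVneq J 0 => /ltW yh.
  by rewrite powR0 ?lt0r_neq0// add0r powR_le_mul.
apply: (@le_trans _ _ (J `^ alpha + e * J)); last first.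
  by rewrite lerD2l ler_wpM2l// ltW.
have K0 : 0 <= J `^ alpha + e * J.
  by rewrite addr_ge0 ?powR_ge0// mulr_ge0// ltW.
rewrite -[leRHS](powR_invK K0 (lt0r_neq0 al0)).
by rewrite ge0_ler_powR ?nnegrE ?powR_ge0// ltW.
Unshelve. all: by end_near. Qed.

Lemma fine_cell_left (R : realType) (a b : R) (g : R -> R) (alpha e x : R) :
  {in `[a, b] &, {homo g : u v / u <= v}} -> left_continuous_on a b g ->
  1 < alpha -> 0 < e -> a < x -> x <= b ->
  \forall y \near x^'-, fine_cell g alpha e y x.
Proof.
move=> gnd glc al1 e0 ax xb.
have /glc gx : x \in `]a, b] by rewrite in_itv/= ax.
near=> y.
have yx : y < x by near: y; exact: nbhs_left_lt.
have ay : a <= y by near: y; exact: nbhs_left_ge.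
have ye : g x - e `^ (alpha - 1)^-1 < g y.
  by near: y; apply: (cvgr_gt _ gx); rewrite gtrBl powR_gt0.
(* The jump term at [y] is only used as nonnegative: the error term alone absorbs the increment. *)
rewrite /fine_cell yx /=; apply: ler_wpDl; first exact: powR_ge0.
apply: powR_le_mul => //; last by rewrite lerBlDl -lerBlDr ltW.
by rewrite subr_ge0; apply: gnd; rewrite ?in_itv/= ?ay ?xb ?(ltW ax) ?(ltW yx)
  ?(le_trans (ltW yx)).
Unshelve. all: by end_near. Qed.

(* A Cousin-type lemma, by real induction: the supremum of the points reachable
   from [s] along [r] is reachable, and equals [t]. *)
Lemma fine_partition (R : realType) (r : rel R) (s t : R) : s <= t ->
  (forall x, s <= x -> x < t -> \forall y \near x^'+, r x y) ->
  (forall x, s < x -> x <= t -> \forall y \near x^'-, r y x) ->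
  exists2 p, path r s p & last s p = t.
Proof.
move=> st rR rL.
pose E := [set x | s <= x <= t /\ exists2 p, path r s p & last s p = x].
have Es : E s by split; [rewrite lexx st|exists [::]].
have hsE : has_sup E by split; [exists s|exists t => x [/andP[]]].
have sc : s <= sup E by apply: ub_le_sup => //; case: hsE.
have ct : sup E <= t by apply: ge_sup; [exists s|move=> x [/andP[]]].
have step x y : E x -> r x y -> s <= y <= t -> E y.
  move=> [_ [p rp <-]] rxy yt; split=> //.
  by exists (rcons p y); rewrite ?rcons_path ?rp ?last_rcons.
have Ec : E (sup E).
  move: sc; rewrite le_eqVlt => /predU1P[<-//|sc].
  (* Some [y] in [E] is so close to [sup E] that it either equals it or reaches it in one step. *)
  have [d d0 rd] := rL _ sc ct; have [y Ey dy] := sup_adherent d0 hsE.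
  have : y <= sup E by apply: ub_le_sup => //; case: hsE.
  rewrite le_eqVlt => /predU1P[<-//|yc].
  apply: (step _ _ Ey); last by rewrite (ltW sc).
  apply: rd => //=.
  by rewrite gtr0_norm ?subr_gt0// ltrBlDr -ltrBlDl.
move: ct; rewrite le_eqVlt => /predU1P[ct|ct]; first by case: Ec; rewrite ct.
(* If [sup E < t], one more step to the right lands in [E] beyond its supremum. *)
near (sup E)^'+ => y.
have cy : sup E < y by near: y; exact: nbhs_right_gt.
have yt : y <= t by near: y; exact: nbhs_right_ltW.
have : y <= sup E.
  apply: ub_le_sup; first by case: hsE.
  apply: (step _ _ Ec); first by near: y; exact: rR.
  by rewrite yt (le_trans sc)// ltW.
by rewrite leNgt cy.
Unshelve. all: by end_near. Qed.

(** The increments of [g] telescope; [belast s p] lists the left endpoints of the cells. *)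
Lemma power_sum_fine_le (R : realType) (g : R -> R) (alpha e s t : R)
    (p : seq R) :
  path (fine_cell g alpha e) s p ->
  power_sum alpha g s t p <=
  \sum_(u <- belast s p) right_jump g u `^ alpha + e * (g (last s p) - g s).
Proof.
elim: p s => [|x p IH] s /=.
  by rewrite power_sum_nil big_nil subrr mulr0 addr0.
move=> /andP[/andP[_ sx] /IH xp].
rewrite power_sum_cons big_cons; apply: le_trans (lerD sx xp) _.
by rewrite addrACA -mulrDr (addrC (g x - g s)) subrKA.
Qed.

Theorem theorem7p2 (R : realType) (a b : R) (g : R -> R) (alpha : R)
    (hab : a <= b)
    (g_nondecreasing : {in `[a, b] &, {homo g : x y / x <= y}})
    (g_left_continuous : left_continuous_on a b g)
    (halpha : 1 < alpha)
    (s t : R) (has : a <= s) (hst : s < t) (htb : t <= b) :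
  (inf [set power_sum alpha g s t p | p in itv_partition s t])%:E =
  \esum_(tau in [set tau | s <= tau < t /\ 0 < right_jump g tau])
     (right_jump g tau `^ alpha)%:E.
Proof.
set Q := [set power_sum _ _ _ _ _ | _ in _].
set D := [set tau | _].
set S := esum _ _.
have SQ x : Q x -> (S <= x%:E)%E.
  move=> [p pst <-]; apply: ge_ereal_sup => _ [A [finA AD] <-].
  rewrite fsbig_finite//= sumEFin lee_fin.
  apply: le_trans (sum_right_jump_powR_le_power_sum g_nondecreasing (ltW halpha)
    (fset_uniq (fset_set A)) has htb pst).
  rewrite big_seq_cond [leRHS]big_seq_cond le_eqVlt.
  apply/predU1P; left; apply: eq_bigl => u.
  rewrite andbT; case: (boolP (u \in _)) => //=.
  by rewrite in_fset_set// inE => /AD[->].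
have Q0 : Q !=set0.
  by exists (power_sum alpha g s t [:: t]), [:: t] => //; exact: itv_partition1.
have S0 : (0 <= S)%E by apply: esum_ge0 => x _; rewrite lee_fin powR_ge0.
(* A single power sum already bounds [S], so the rest compares real numbers. *)
have Sfin : S \is a fin_num.
  by case: Q0 => y /SQ Sy; rewrite ge0_fin_numE// (le_lt_trans Sy) ?ltry.
have lQ : lbound Q (fine S).
  by move=> y /SQ Sy; rewrite -lee_fin fineK.
rewrite -[RHS]fineK//; congr EFin; apply/eqP; rewrite eq_le; apply/andP; split.
  apply/ler_addgt0Pr => d d0.
  have G0 : 0 <= g t - g s.
    by rewrite subr_ge0; apply: g_nondecreasing (ltW hst);
      rewrite in_itv/= ?has ?htb ?(le_trans has (ltW hst))
        ?(le_trans (ltW hst)).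
  (* Chosen so that [e * (g t - g s) <= d]; the [+ 1] keeps the denominator positive when
     [g t = g s]. *)
  pose e := d / (g t - g s + 1).
  have e0 : 0 < e by rewrite divr_gt0// ltr_wpDl.
  have [||p rp pt] := @fine_partition _ (fine_cell g alpha e) s t (ltW hst).
  - move=> x sx xt; apply: (fine_cell_right g_nondecreasing) => //.
      exact: le_trans sx.
    exact: lt_le_trans htb.
  - move=> x sx xt; apply: (fine_cell_left g_nondecreasing) => //.
      exact: le_lt_trans sx.
    exact: le_trans htb.
  have ltp : path <%O s p by apply: sub_path rp => u v /andP[].
  have pst : itv_partition s t p by split=> //; rewrite pt.
  apply: (@le_trans _ _ (power_sum alpha g s t p)).
    by apply: ge_inf; [exists (fine S)|exists p].
  apply: le_trans (power_sum_fine_le t rp) _; rewrite pt lerD//; last first.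
    rewrite /e -mulrA ler_piMr ?(ltW d0)// mulrC ler_pdivrMr ?mul1r ?lerDl//.
    by rewrite ltr_wpDl.
  rewrite -lee_fin fineK//; apply: esum_ge.
  pose B := [seq u <- belast s p | 0 < right_jump g u].
  have sp : sorted <%O (rcons (belast s p) t).
    by rewrite -[X in rcons _ X]pt -lastI.
  have Bin u : u \in belast s p -> s <= u < t.
    move=> up; apply/andP; split.
      move: (mem_belast up); rewrite inE => /predU1P[->//|].
      by move=> /(allP (order_path_min lt_trans ltp))/ltW.
    move: sp; rewrite -cats1 (sorted_pairwise lt_trans) pairwise_cat allrel1r.
    by move=> /andP[/allP/(_ _ up)].
  have uB : uniq (belast s p).
    by move: (lt_sorted_uniq sp); rewrite rcons_uniq => /andP[].
  exists [set` B].
    split=> [|u]; first exact: finite_seq.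
    by rewrite /= mem_filter => /andP[? /Bin].
  rewrite -fsbig_seq ?filter_uniq// big_filter sumEFin lee_fin.
  rewrite big_seq [leRHS]big_mkcond [leRHS]big_seq; apply: ler_sum => u.
  move=> /Bin/andP[su ut]; case: ifPn => //; rewrite -leNgt => Ju0.
  have J0u := right_jump_ge0 g_nondecreasing (le_trans has su)
    (lt_le_trans ut htb).
  have -> : right_jump g u = 0 by apply/eqP; rewrite eq_le Ju0.
  by rewrite powR0 ?gt_eqF// (lt_trans ltr01).
exact: lb_le_inf.
Qed.
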